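(* Let $n \ge 2$ and let $\lambda=(\lambda_1,\ldots,\lambda_r)$ be a partition of $n$. Then $\eta_\lambda \neq 0$ and \[ \mathrm{sign}(\eta_\lambda) = (-1)^{n-\lambda_1}, \] i.e. $\eta_\lambda$ is positive if the number of cells below the first row of the Ferrers diagram of $\lambda$ is even, and negative if it is odd.
   Context: For $n\ge 1$, $\mathcal{D}_n\subseteq S_n$ denotes the set of derangements (fixed-point-free permutations) of $\{1,\ldots,n\}$. For a partition $\lambda\vdash n$, $\chi_\lambda$ is the irreducible character of $S_n$ indexed by $\lambda$ (standard indexing, $(n)$ the trivial character), and $\eta_\lambda=\frac{1}{\chi_\lambda(1)}\sum_{\sigma\in\mathcal{D}_n}\chi_\lambda(\sigma)$; these are the eigenvalues of the derangement graph, the Cayley graph $\Gamma(S_n,\mathcal{D}_n)$. Partitions are written as weakly decreasing sequences of positive parts; $\mathrm{sign}(x)$ is $1$ for $x>0$ and $-1$ for $x<0$. *)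

(* Defs.v *)
From mathcomp Require Export all_boot all_order all_algebra all_fingroup.
From mathcomp Require Export all_solvable all_field all_character.

Set Implicit Arguments.
Unset Strict Implicit.
Unset Printing Implicit Defensive.

Export GRing.Theory Num.Theory.

Definition is_partition (n : nat) (la : seq nat) : bool :=
  [&& sorted geq la, all (fun k => 0 < k) la & sumn la == n].

(* The tableau of shape [la] in which the entries 0, ..., n-1 are placed in
   reading order (along the first row, then along the second, and so on):
   [row_of la i] and [col_of la i] are the coordinates of the cell holding i,
   both counted from 0. *)
Definition row_of (la : seq nat) (i : nat) : nat := reshape_index la i.
Definition col_of (la : seq nat) (i : nat) : nat := reshape_offset la i.

Definition row_stab (n : nat) (la : seq nat) : {set 'S_n} :=
  [set p : 'S_n | [forall i : 'I_n, row_of la (p i) == row_of la i]].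

Definition col_stab (n : nat) (la : seq nat) : {set 'S_n} :=
  [set q : 'S_n | [forall i : 'I_n, col_of la (q i) == col_of la i]].

(* The Young symmetrizer c = a b, with a = sum_p p and b = sum_q sgn(q) q, as
   a row vector of the regular representation.  Products in {perm T} are
   composed from left to right, (q * p) x = p (q x), so [q * p] below is the
   composite "p after q", i.e. the product p q in the usual convention. *)
Definition young_symmetrizer (n : nat) (la : seq nat) :
    'rV[algC]_(#|[set: 'S_n]|) :=
  (\sum_(p in row_stab n la) \sum_(q in col_stab n la)
     (-1) ^+ (odd_perm q) *:
       delta_mx 0 (gring_index [set: 'S_n]%G (q * p)%g))%R.

(* [regular_repr] acts by multiplication on the right, which for the reversed
   product of {perm T} is multiplication on the left in the usual convention:
   [specht_mx n la] is the left ideal C[S_n] c. *)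
Definition specht_mx (n : nat) (la : seq nat) :
    'M[algC]_(#|[set: 'S_n]|) :=
  cyclic_mx (regular_repr algC [set: 'S_n]%G) (young_symmetrizer n la).

Definition specht_repr (n : nat) (la : seq nat) :
    mx_representation algC [set: 'S_n]%G (\rank (specht_mx n la)) :=
  submod_repr (cyclic_mx_module (regular_repr algC [set: 'S_n]%G)
                 (young_symmetrizer n la)).

Definition chi (n : nat) (la : seq nat) : 'CF([set: 'S_n]) :=
  cfRepr (specht_repr n la).

Definition derangements (n : nat) : {set 'S_n} :=
  [set s : 'S_n | [forall i : 'I_n, s i != i]].

Definition eta (n : nat) (la : seq nat) : algC :=
  ((chi n la 1%g)^-1 * \sum_(s in derangements n) chi n la s)%R.

(* Main.v *)
Require Import Defs.

(* The sum D of all derangements is central, so D c = a D b is a multiple of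
   the Young symmetrizer c = a b, and the factor is the coefficient of the
   identity: eta = sum_(p, q) sgn(q) [p q is a derangement], with p in the row
   stabilizer and q in the column stabilizer.  The product p q fixes a cell iff
   both p and q do, so for fixed p the sum over q is the determinant of the
   matrix [i, j in the same column] - [i = j is fixed by p].  It splits over
   the columns: a column of height h contributes (-1)^(h-1) times h - 1, 1 or 0
   according to whether p moves none, one, or at least two of its cells.  Hence
   (-1)^(n - la_1) eta is a sum of nonnegative integers; it is positive because
   of the p that moves exactly the cells of the first row or, when there is
   only one column, of p = 1. *)

Set Implicit Arguments.
Unset Strict Implicit.
Unset Printing Implicit Defensive.

(** * Determinant of a diagonal matrix minus the same-fibre indicator *)

Section DiagonalMinusFibres.
Local Open Scope ring_scope.

(** Both sides are the determinant of the block matrix [B], triangularized once by column operations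
    and once by row operations. *)
Lemma det_sub_mulmx (F : fieldType) n k (D : 'M[F]_n) (U : 'M[F]_(n, k))
    (V : 'M[F]_(k, n)) :
  D \in unitmx -> \det (D - U *m V) = \det D * \det (1%:M - V *m invmx D *m U).
Proof.
move=> uD; set B := block_mx D U V (1%:M : 'M_k).
have /(congr1 determinant): B *m block_mx 1%:M 0 (- V) 1%:M
    = block_mx (D - U *m V) U 0 1%:M.
  by rewrite mulmx_block !mulmx1 !mulmx0 mul1mx mulmxN subrr !add0r.
rewrite det_mulmx det_lblock det_ublock !det1 !mulr1 => <-.
have /(congr1 determinant): block_mx 1%:M 0 (- (V *m invmx D)) 1%:M *m B
    = block_mx D U 0 (1%:M - V *m invmx D *m U).
  by rewrite mulmx_block !mul1mx !mul0mx !addr0 !mulNmx mulmxKV // addNr addrC.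
by rewrite det_mulmx det_lblock det_ublock !det1 !mul1r => <-.
Qed.

Definition diag_sub_fibre (R : pzRingType) n k (c : 'I_n -> 'I_k)
    (d : 'I_n -> R) : 'M[R]_n :=
  \matrix_(i, j) (d i *+ (i == j) - (c i == c j)%:R).

(** The determinant of diag(d) - J on one fibre, J being the all-ones matrix, written without
    division so that [d] may vanish. *)
Definition fibre_weight (R : pzRingType) n k (c : 'I_n -> 'I_k)
    (d : 'I_n -> R) (a : 'I_k) : R :=
  \prod_(i | c i == a) d i
    - \sum_(i | c i == a) \prod_(j | (c j == a) && (j != i)) d j.

(** With [U] the incidence matrix of indices and fibres, the matrix is D - U U^T, and 1 - U^T D^-1 U
    is diagonal because fibres are disjoint. *)
Lemma det_diag_sub_fibre_unit (F : fieldType) n k (c : 'I_n -> 'I_k)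
    (d : 'I_n -> F) :
  (forall i, d i != 0) ->
  \det (diag_sub_fibre c d) = \prod_a fibre_weight c d a.
Proof.
move=> d0; pose U := \matrix_(i < n, a < k) (c i == a)%:R : 'M[F]_(n, k).
pose D := diag_mx (\row_i d i).
pose E := diag_mx (\row_i (d i)^-1).
have DE : D *m E = 1%:M.
  apply/matrixP=> i j; rewrite mul_diag_mx !mxE.
  by case: eqP => [->|_]; rewrite ?mulr1n ?mulr0n ?mulr0 ?divff.
have uD : D \in unitmx by case: (mulmx1_unit DE).
have invD : invmx D = E by rewrite -[RHS](mulKmx uD) DE mulmx1.
have -> : diag_sub_fibre c d = D - U *m U^T.
  apply/matrixP=> i j; rewrite !mxE; congr (_ - _).
  rewrite (bigD1 (c i)) //= big1 => [|a ai]; rewrite !mxE ?eqxx ?mul1r ?addr0 //.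
    by rewrite eq_sym.
  by rewrite eq_sym (negPf ai) mul0r.
rewrite det_sub_mulmx // invD det_diag.
have -> : 1%:M - U^T *m E *m U
    = diag_mx (\row_a (1 - \sum_(i | c i == a) (d i)^-1)).
  apply/matrixP=> a b; rewrite mul_mx_diag !mxE.
  under eq_bigr => i _ do rewrite !mxE.
  have [<-|ab] := eqVneq a b; rewrite ?mulr1n ?mulr0n.
    congr (_ - _); rewrite [RHS]big_mkcond /=; apply: eq_bigr => i _.
    by case: eqP => _; rewrite ?mul1r ?mulr1 // !mul0r.
  rewrite big1 ?subr0 // => i _.
  by have [->|_] := eqVneq (c i) a; rewrite ?(negPf ab) ?mulr0 ?mul0r.
rewrite det_diag (partition_big c xpredT) //= -big_split /=.
apply: eq_bigr => a _; rewrite mxE /fibre_weight mulrBr mulr1; congr (_ - _).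
  by apply: eq_bigr => i _; rewrite mxE.
rewrite mulr_sumr; apply: eq_bigr => i ia.
rewrite (bigD1 i) //= mxE mulrAC divff // mul1r.
by apply: eq_bigr => j _; rewrite mxE.
Qed.

(* The entries of d may vanish: replace d i by the nonzero polynomial
   'X + d i, invert in the fraction field, and evaluate at 0. *)
Lemma det_diag_sub_fibre (R : idomainType) n k (c : 'I_n -> 'I_k)
    (d : 'I_n -> R) :
  \det (diag_sub_fibre c d) = \prod_a fibre_weight c d a.
Proof.
(* Both sides commute with ring morphisms; this serves for [tofrac] and for evaluation at 0. *)
have map_fibre (A B : comNzRingType) (f : {rmorphism A -> B}) (e : 'I_n -> A) :
    (\det (diag_sub_fibre c (f \o e)) = f (\det (diag_sub_fibre c e))) *
    (\prod_a fibre_weight c (f \o e) a = f (\prod_a fibre_weight c e a)).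
  split.
    rewrite -det_map_mx; congr determinant; apply/matrixP=> i j.
    by rewrite !mxE rmorphB rmorphMn rmorph_nat.
  rewrite rmorph_prod; apply: eq_bigr => a _.
  rewrite /fibre_weight rmorphB rmorph_prod rmorph_sum; congr (_ - _).
  by apply: eq_bigr => i _; rewrite rmorph_prod.
pose e i : {poly R} := 'X + (d i)%:P.
have e0 i : tofrac (e i) != 0 by rewrite tofrac_eq0 -size_poly_eq0 size_XaddC.
have := det_diag_sub_fibre_unit c e0.
rewrite -[fun i => _]/(@tofrac _ \o e) !map_fibre => /eqP.
rewrite tofrac_eq => /eqP/(congr1 (horner_eval 0)).
rewrite -!map_fibre.
have eq_d : horner_eval 0 \o e =1 d.
  by move=> i; rewrite /= /horner_eval !hornerE.
have -> : diag_sub_fibre c (horner_eval 0 \o e) = diag_sub_fibre c d.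
  by apply/matrixP=> i j; rewrite !mxE eq_d.
move=> ->; apply: eq_bigr => a _; rewrite /fibre_weight.
congr (_ - _); first exact: eq_bigr.
by apply: eq_bigr => i _; apply: eq_bigr.
Qed.

(** Singling out one index [i0] of the fibre leaves no negative term when all [d i] lie between 0
    and 1. *)
Lemma opp_fibre_weightE (R : comNzRingType) n k (c : 'I_n -> 'I_k)
    (d : 'I_n -> R) i0 :
  - fibre_weight c d (c i0)
    = (1 - d i0) * \prod_(j | (c j == c i0) && (j != i0)) d j
      + \sum_(i | (c i == c i0) && (i != i0))
          \prod_(j | (c j == c i0) && (j != i)) d j.
Proof.
rewrite /fibre_weight opprB (bigD1 i0) //= [X in _ - X](bigD1 i0) //=.
by rewrite mulrBl mul1r addrAC.
Qed.

Lemma opp_fibre_weight_ge0 (R : numDomainType) n k (c : 'I_n -> 'I_k)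
    (d : 'I_n -> R) i0 :
  (forall i, 0 <= d i <= 1) -> 0 <= - fibre_weight c d (c i0).
Proof.
move=> d01; have d0 i : 0 <= d i by case/andP: (d01 i).
rewrite opp_fibre_weightE addr_ge0 ?sumr_ge0 // => [|i _].
  rewrite mulr_ge0 ?prodr_ge0 // subr_ge0; by case/andP: (d01 i0).
exact: prodr_ge0.
Qed.

(** All factors away from [i0] are 1, so in the expansion at [i0] the first summand is 1 if [b i0]
    fails, and otherwise the summand of [i1] is 1. *)
Lemma opp_fibre_weight_gt0 (R : numDomainType) n k (c : 'I_n -> 'I_k)
    (b : pred 'I_n) i0 :
  (forall j, c j = c i0 -> j != i0 -> b j) ->
  ~~ b i0 \/ (exists2 i1, c i1 = c i0 & i1 != i0 /\ b i0) ->
  0 < - fibre_weight c (fun i => (b i)%:R : R) (c i0).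
Proof.
move=> b1 hi0; rewrite opp_fibre_weightE.
rewrite [X in _ * X]big1 => [|j /andP[/eqP cj ji]]; last by rewrite b1.
rewrite mulr1; case: hi0 => [/negPf->|[i1 ci1 [i10 bi0]]].
  by rewrite subr0 ltr_wpDr // sumr_ge0 // => i _; apply: prodr_ge0.
rewrite bi0 subrr add0r (bigD1 i1) ?ci1 ?eqxx //= ltr_wpDr //.
  by rewrite sumr_ge0 // => i _; apply: prodr_ge0.
rewrite big1 // => j /andP[/eqP cj _].
by have [->|ji] := eqVneq j i0; rewrite ?bi0 ?b1.
Qed.

(** Leibniz expansion of the negated matrix: if [q] moves some index out of its fibre it meets a
    zero entry, otherwise it meets only entries 0 and 1. Negating the matrix costs (-1)^n, negating
    the weights (-1)^k. *)
Lemma fibre_alternating_sum (R : idomainType) n k (c : 'I_n -> 'I_k)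
    (b : pred 'I_n) :
  \sum_(q : 'S_n | [forall i, c (q i) == c i])
      (-1) ^+ q * [forall i, ~~ (b i && (q i == i))]%:R
    = (-1) ^+ (n + k)
      * \prod_a - fibre_weight c (fun i => (b i)%:R : R) a.
Proof.
rewrite exprD prodrN card_ord -mulrA [X in _ * X]mulrA -exprMn mulrNN mulr1 expr1n.
rewrite mul1r -det_diag_sub_fibre -detZ [RHS]/determinant big_mkcond /=.
apply: eq_bigr => q _; case: ifP => [/forallP cq | /forallPn[i ci]].
  congr (_ * _); case: (altP forallP) => [bq | /forallPn[i]].
    rewrite big1 // => i _; rewrite !mxE eq_sym [c i == _]eq_sym (eqP (cq i)) eqxx.
    move: (bq i); rewrite negb_and mulr1n.
    by case: eqP; case: (b i) => //= _ _; rewrite ?mulr0n sub0r mulN1r opprK.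
  rewrite negbK => /andP[bi /eqP qi].
  by rewrite (bigD1 i) //= !mxE qi !eqxx bi subrr mulr0 mul0r.
rewrite (bigD1 i) //= !mxE eq_sym [c i == _]eq_sym (negPf ci) subr0.
suff /negPf->: q i != i by rewrite mulr0n !(mulr0, mul0r).
by apply: contraNneq ci => ->.
Qed.

End DiagonalMinusFibres.

(** * Cells of the tableau and the factorization of permutations *)

Lemma cell_inj la i j :
  row_of la i = row_of la j -> col_of la i = col_of la j -> i = j.
Proof.
rewrite /row_of /col_of => rij cij.
by rewrite -(reshape_indexK la i) rij cij reshape_indexK.
Qed.

Lemma cell_exists n la r k :
  sumn la = n -> k < nth 0 la r ->
  exists2 i : 'I_n, row_of la i = r & col_of la i = k.
Proof.
move=> <- lt_k; exists (Ordinal (flatten_indexP lt_k)).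
  exact: flatten_indexKl.
exact: flatten_indexKr.
Qed.

Lemma col_lt_row_size n la (i : 'I_n) :
  sumn la = n -> col_of la i < nth 0 la (row_of la i).
Proof. by move=> sum_la; apply: reshape_offsetP; rewrite sum_la. Qed.

Lemma row_lt_size n la (i : 'I_n) : sumn la = n -> row_of la i < size la.
Proof. by move=> sum_la; apply: reshape_indexP; rewrite sum_la. Qed.

(* Among the first k columns, row r of the tableau moved by g holds at most
   min(k, la_r) entries, which is what it holds in the tableau itself; summing
   over r forces equality everywhere, and k = la_r gives the claim. *)
Lemma col_lt_moved_row_size n la (g : 'S_n) :
  sumn la = n ->
  (forall i j : 'I_n, i != j -> col_of la i = col_of la j ->
     row_of la (g i) != row_of la (g j)) ->
  forall i : 'I_n, col_of la i < nth 0 la (row_of la (g i)).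
Proof.
move=> sum_la g_dist i0; set k := nth 0 la _.
pose A (r : 'I_(size la)) :=
  [set i : 'I_n | (col_of la i < k) && (row_of la (g i) == r)].
pose B (r : 'I_(size la)) :=
  [set i : 'I_n | (col_of la i < k) && (row_of la i == r)].
have card_row r : #|[set i | row_of la (g i) == r]|
    = #|[set i : 'I_n | row_of la i == r]|.
  rewrite -(card_preimset [set i : 'I_n | row_of la i == r] (@perm_inj _ g)).
  by apply: eq_card => i; rewrite !inE.
have B_row (r : 'I_(size la)) :
    nth 0 la r <= k -> B r = [set i : 'I_n | row_of la i == r].
  move=> le_k; apply/setP=> i; rewrite !inE andb_idl // => /eqP ri.
  by apply: leq_trans le_k; rewrite -ri col_lt_row_size.
have leAB r : #|A r| <= #|B r|.
  have [le_k | /ltnW le_k] := leqP (nth 0 la r) k.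
    rewrite B_row // -card_row; apply: subset_leq_card.
    by apply/subsetP=> i; rewrite !inE => /andP[].
  (* In a row longer than [k], the entries of [A r] have distinct columns below [k], while [B r]
     contains the first [k] cells. *)
  apply: (@leq_trans k).
    case: (posnP k) => [k0 | k_gt0].
      by rewrite k0 leqn0 cards_eq0; apply/eqP/setP=> i; rewrite !inE k0.
    pose h (i : 'I_n) : 'I_k := insubd (Ordinal k_gt0) (col_of la i).
    rewrite -[X in _ <= X]card_ord -(@card_in_imset _ _ h) ?max_card //.
    move=> i j; rewrite !inE => /andP[ik /eqP ri] /andP[jk /eqP rj].
    move/(congr1 val); rewrite !val_insubd ik jk => cij.
    apply/eqP/idPn => /g_dist/(_ cij); by rewrite ri rj eqxx.
  have /fin_all_exists[h hP] (a : 'I_k) :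
      exists i : 'I_n, row_of la i = r /\ col_of la i = a.
    have lt_a := leq_trans (ltn_ord a) le_k.
    by have [i ri ci] := cell_exists sum_la lt_a; exists i.
  have h_inj : injective h.
    move=> a b hab; apply: val_inj.
    by rewrite /= -(proj2 (hP a)) hab (proj2 (hP b)).
  rewrite -[X in X <= _]card_ord -cardsT -(card_imset _ h_inj).
  apply/subset_leq_card/subsetP=> _ /imsetP[a _ ->].
  by rewrite inE (proj1 (hP a)) (proj2 (hP a)) ltn_ord eqxx.
have sumA : \sum_r #|A r| = #|[set i : 'I_n | col_of la i < k]|.
  pose row_g i := Ordinal (row_lt_size (g i) sum_la).
  rewrite -sum1_card (partition_big row_g xpredT) //=.
  by apply: eq_bigr => r _; rewrite -sum1_card; apply: eq_bigl => i; rewrite !inE.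
have sumB : \sum_r #|B r| = #|[set i : 'I_n | col_of la i < k]|.
  pose row i := Ordinal (row_lt_size i sum_la).
  rewrite -sum1_card (partition_big row xpredT) //=.
  by apply: eq_bigr => r _; rewrite -sum1_card; apply: eq_bigl => i; rewrite !inE.
have [_] := leqif_sum (P := xpredT) (fun r _ => leqif_eq (leAB r)).
rewrite sumA sumB eqxx => /esym/forallP.
move/(_ (Ordinal (row_lt_size (g i0) sum_la))) => /eqP/=.
rewrite B_row // -card_row => cardA.
(* Here [k] is the length of the row, so by cardinality [A] contains everything that [g] sends to
   that row, in particular [i0]. *)
suff: i0 \in A (Ordinal (row_lt_size (g i0) sum_la)) by rewrite inE => /andP[].
suff -> : A (Ordinal (row_lt_size (g i0) sum_la))
    = [set i | row_of la (g i) == row_of la (g i0)] by rewrite inE.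
apply/eqP; rewrite eqEcard cardA leqnn andbT.
by apply/subsetP=> i; rewrite !inE => /andP[].
Qed.

(* von Neumann's lemma: q sends i to the cell in the row of g i and the
   column of i. *)
Lemma mem_col_row_stab n la (g : 'S_n) :
  sumn la = n ->
  (forall i j : 'I_n, i != j -> col_of la i = col_of la j ->
     row_of la (g i) != row_of la (g j)) ->
  exists q, exists2 p, q \in col_stab n la /\ p \in row_stab n la
                     & g = (q * p)%g.
Proof.
move=> sum_la g_dist.
have /fin_all_exists[f fP] (i : 'I_n) : exists j : 'I_n,
    row_of la j = row_of la (g i) /\ col_of la j = col_of la i.
  have [j rj cj] := cell_exists sum_la (col_lt_moved_row_size sum_la g_dist i).
  by exists j.
have f_inj : injective f.
  move=> i j fij; apply/eqP/idPn => /g_dist.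
  have [<- <-] := fP i; have [<- <-] := fP j.
  by rewrite fij eqxx => /(_ erefl).
exists (perm f_inj), ((perm f_inj)^-1 * g)%g; last by rewrite mulKVg.
split; rewrite inE; apply/forallP=> i; first by rewrite permE (proj2 (fP i)).
rewrite permM -(proj1 (fP _)).
by have := permKV (perm f_inj) i; rewrite permE => ->.
Qed.

(** * Row and column stabilizers *)

Lemma row_stab_group_set n la : group_set (row_stab n la).
Proof.
apply/group_setP; split=> [|p q]; rewrite !inE.
  by apply/forallP=> i; rewrite perm1.
move=> /forallP pP /forallP qP; apply/forallP=> i.
by rewrite permM (eqP (qP _)) pP.
Qed.
Canonical row_stab_group n la := Group (row_stab_group_set n la).

Lemma col_stab_group_set n la : group_set (col_stab n la).
Proof.
apply/group_setP; split=> [|p q]; rewrite !inE.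
  by apply/forallP=> i; rewrite perm1.
move=> /forallP pP /forallP qP; apply/forallP=> i.
by rewrite permM (eqP (qP _)) pP.
Qed.
Canonical col_stab_group n la := Group (col_stab_group_set n la).

(** If p (q i) = i, then q i is in the row of i because p preserves rows, and in its column because
    q preserves columns; so q i = i. *)
Lemma col_row_stab_eq n la (q p : 'S_n) i :
  q \in col_stab n la -> p \in row_stab n la ->
  ((q * p)%g i == i) = (p i == i) && (q i == i).
Proof.
rewrite !inE permM => /forallP qC /forallP pR.
apply/eqP/andP=> [pqi | [/eqP pi /eqP ->]] //.
suff qi : q i = i by rewrite -{1}qi pqi qi.
apply/val_inj/(@cell_inj la) => /=; last exact/eqP.
by apply/esym; rewrite -{1}pqi; apply/eqP.
Qed.

Lemma tperm_stab (n : nat) (i j : 'I_n) (r : nat -> nat) :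
  r i = r j -> [forall k, r (tperm i j k) == r k].
Proof. by move=> rij; apply/forallP=> k; case: tpermP => [->|->|//]; rewrite rij. Qed.

(** * The Young symmetrizer and the eigenvalue of the derangement sum *)

Section YoungSymmetrizer.
Local Open Scope ring_scope.

(** Coefficient functions of the x in C[S_n] with p x q = sgn(q) x, in the usual convention. *)
Definition young_equivariant n la (f : 'S_n -> algC) :=
  (forall q g, q \in col_stab n la -> f (q * g)%g = (-1) ^+ q * f g) /\
  (forall p g, p \in row_stab n la -> f (g * p)%g = f g).

(** If [g] sends two entries of one column to one row, a transposition passes through [g] and forces
    the value to equal its opposite. Otherwise g = q * p, and the value at 1 determines the value at
    [g]. *)
Lemma young_equivariant_scale n la (f h : 'S_n -> algC) :
  sumn la = n -> young_equivariant la f -> young_equivariant la h -> h 1%g = 1 ->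
  forall g, f g = f 1%g * h g.
Proof.
move=> sum_la [fC fR] [hC hR] h1 g.
have [bad | good] := boolP [exists i : 'I_n, exists j : 'I_n,
    [&& i != j, col_of la i == col_of la j & row_of la (g i) == row_of la (g j)]].
  have [i /existsP[j /and3P[ij /eqP cij /eqP rij]]] := existsP bad.
  have tC : tperm i j \in col_stab n la by rewrite inE tperm_stab.
  have tR : tperm (g i) (g j) \in row_stab n la by rewrite inE tperm_stab.
  have tg : (tperm i j * g = g * tperm (g i) (g j))%g.
    by rewrite -tpermJ conjgE !mulgA mulgV mul1g.
  have vanish (k : 'S_n -> algC) : young_equivariant la k -> k g = 0.
    case=> kC kR; have: k g *+ 2 == 0.
      by rewrite mulr2n -{1}(kR _ g tR) -tg kC // odd_tperm ij expr1 mulN1r addNr.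
    by rewrite mulrn_eq0 => /eqP.
  by rewrite !vanish ?mulr0.
have [|q [p [qC pR] ->]] := mem_col_row_stab (g := g) sum_la.
  move=> i j ij cij; apply: contra good => rij.
  by apply/existsP; exists i; apply/existsP; exists j; rewrite ij cij eqxx.
by rewrite !(fR, hR) // -[q]mulg1 fC // hC // h1 mulr1 mulrC.
Qed.

Section Coordinates.
Variables (n : nat) (la : seq nat).
Let G := [set: 'S_n]%G.
Let aG := regular_repr algC G.
Let coord (v : 'rV[algC]_(#|[set: 'S_n]|)) (g : 'S_n) := v 0 (gring_index G g).

Lemma coord_delta (g h : 'S_n) : coord (delta_mx 0 (gring_index G g)) h = (h == g)%:R.
Proof.
rewrite /coord mxE eqxx /=; congr (_%:R); congr nat_of_bool.
apply/eqP/eqP=> [/(congr1 enum_val)|->//].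
by rewrite !gring_indexK ?inE.
Qed.

Lemma coord_young g : coord (young_symmetrizer n la) g
  = \sum_(p in row_stab n la) \sum_(q in col_stab n la)
      (-1) ^+ q * (g == q * p)%g%:R.
Proof.
rewrite /coord /young_symmetrizer !summxE; apply: eq_bigr => p _.
rewrite summxE; apply: eq_bigr => q _.
by rewrite mxE -[delta_mx _ _ _ _]/(coord _ _) coord_delta.
Qed.

Lemma coord_act v s g : coord (v *m aG s) g = coord v (g * s^-1)%g.
Proof.
rewrite /coord mxE (bigD1 (gring_index G (g * s^-1)%g)) //= big1 => [|i ne].
  rewrite mxE gring_indexK ?inE // mulgKV -[delta_mx _ _ _ _]/(coord _ _).
  by rewrite coord_delta eqxx mulr1 addr0.
rewrite mxE -[delta_mx _ _ _ _]/(coord _ _) coord_delta.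
case: eqP => [gs|]; last by rewrite mulr0.
by rewrite gs mulgK gring_valK eqxx in ne.
Qed.

Lemma coord_young_equivariant : young_equivariant la (coord (young_symmetrizer n la)).
Proof.
split=> [q0 g q0C | p0 g p0R]; rewrite !coord_young.
  rewrite mulr_sumr; apply: eq_bigr => p _; rewrite mulr_sumr.
  rewrite (reindex_inj (mulgI q0)) /=; apply: eq_big => [q|q _].
    by rewrite groupMl.
  by rewrite odd_permM signr_addb -mulrA -mulgA (inj_eq (mulgI q0)).
rewrite (reindex_inj (mulIg p0)) /=; apply: eq_big => [p|p _].
  by rewrite groupMr.
by apply: eq_bigr => q _; rewrite mulgA (inj_eq (mulIg p0)).
Qed.

(** Only p = q = 1 contributes, since a fixed point of [q * p] is fixed by both. In particular the
    symmetrizer is nonzero. *)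
Lemma coord_young1 : coord (young_symmetrizer n la) 1%g = 1.
Proof.
rewrite coord_young (bigD1 1%g) ?group1 //= (bigD1 1%g) ?group1 //=.
rewrite odd_perm1 expr0 mul1g eqxx mulr1.
have col_row_1 p q : p \in row_stab n la -> q \in col_stab n la ->
    1%g = (q * p)%g -> q = 1%g /\ p = 1%g.
  move=> pR qC qp1.
  have fix_pq i : (p i == i) && (q i == i).
    by rewrite -(col_row_stab_eq i qC pR) -qp1 perm1.
  by split; apply/permP=> i; rewrite perm1; apply/eqP; case/andP: (fix_pq i).
rewrite !big1 ?addr0 // => [p /andP[pR p1] | q /andP[qC q1]].
  rewrite big1 // => q qC; case: eqP => [/col_row_1[]// _ p_1|]; last by rewrite mulr0.
  by rewrite p_1 eqxx in p1.
case: eqP => [/col_row_1[]// q_1|]; last by rewrite mulr0.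
by rewrite q_1 eqxx in q1.
Qed.

Lemma derangementsJ (s x : 'S_n) :
  (s ^ x \in derangements n)%g = (s \in derangements n).
Proof.
rewrite !inE; apply/forallP/forallP => sD i.
  have := sD (x i); rewrite conjgE !permM permK.
  by apply: contraNneq => ->.
rewrite conjgE !permM; apply: contraNneq (sD ((x^-1)%g i)).
by move=> {2}<-; rewrite permK.
Qed.

Lemma derangementsV (s : 'S_n) :
  (s^-1 \in derangements n)%g = (s \in derangements n).
Proof.
rewrite !inE; apply/forallP/forallP => sD i.
  by have := sD (s i); rewrite permK eq_sym.
by have := sD ((s^-1)%g i); rewrite permKV eq_sym.
Qed.

Definition derangement_mx := \sum_(s in derangements n) aG s.

(** The bracket says that [q * p] is a derangement, split by [col_row_stab_eq] so that the inner sum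
    fits [fibre_alternating_sum]. *)
Definition young_eigenvalue : algC :=
  \sum_(p in row_stab n la) \sum_(q in col_stab n la)
    (-1) ^+ q * [forall i, ~~ ((p i == i) && (q i == i))]%:R.

(** Derangements are closed under conjugation, so the left side is again equivariant, hence a
    multiple of the symmetrizer; the factor is its coordinate at 1. *)
Lemma young_derangement : sumn la = n ->
  young_symmetrizer n la *m derangement_mx
    = young_eigenvalue *: young_symmetrizer n la.
Proof.
move=> sum_la; set v := young_symmetrizer n la.
have [vC vR] := coord_young_equivariant.
have coordD g : coord (v *m derangement_mx) g
    = \sum_(s in derangements n) coord v (g * s^-1)%g.
  rewrite mulmx_sumr /coord summxE; apply: eq_bigr => s _; exact: coord_act.
have fE : young_equivariant la (coord (v *m derangement_mx)).
  split=> [q g qC | p g pR]; rewrite !coordD.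
    by rewrite mulr_sumr; apply: eq_bigr => s _; rewrite -mulgA vC.
  rewrite (reindex_inj (conjg_inj p)) /=.
  apply: eq_big => [s|s _]; first exact: derangementsJ.
  by rewrite -conjVg conjgE -!mulgA mulKVg mulgA vR.
apply/rowP=> j; rewrite [RHS]mxE -(gring_valK j).
rewrite -![_ 0 _]/(coord _ _).
rewrite (young_equivariant_scale sum_la fE coord_young_equivariant coord_young1).
congr (_ * _); rewrite coordD.
under eq_bigr => s _ do rewrite mul1g coord_young.
rewrite exchange_big; apply: eq_bigr => p pR; rewrite exchange_big.
apply: eq_bigr => q qC; rewrite -mulr_sumr; congr (_ * _).
(* Only the derangement s = (q * p)^-1 can contribute. *)
rewrite big_mkcond (bigD1 (q * p)^-1%g) //= invgK eqxx derangementsV.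
rewrite big1 => [|s sqp]; last first.
  by case: ifP => // _; rewrite -{1}(invgK (q * p)%g) (inj_eq invg_inj) (negPf sqp).
rewrite addr0 inE (eq_forallb (fun i => congr1 negb (col_row_stab_eq i qC pR))).
by case: ifP.
Qed.

Lemma derangement_mxC (A : 'M_(#|[set: 'S_n]|)) :
  (A \in enveloping_algebra_mx aG)%MS -> A *m derangement_mx = derangement_mx *m A.
Proof.
case/envelop_mxP=> a ->; rewrite mulmx_suml mulmx_sumr; apply: eq_bigr => x _.
rewrite -scalemxAl -scalemxAr; congr (_ *: _).
rewrite mulmx_sumr mulmx_suml (reindex_inj (conjg_inj x)) /=.
apply: eq_big => [s|s _]; first exact: derangementsJ.
by rewrite -!repr_mxM ?inE // conjgE mulKVg.
Qed.

(** Every vector of the Specht module is the symmetrizer times some [A] in the enveloping algebra,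
    and [A] commutes with the derangement sum. The latter thus acts as a scalar, and its trace is
    divided by the nonzero dimension. *)
Lemma eta_young_eigenvalue : sumn la = n -> eta n la = young_eigenvalue.
Proof.
move=> sum_la; rewrite /eta /chi cfRepr1.
under eq_bigr => s _ do rewrite cfunE inE mulr1n.
rewrite -linear_sum /=.
have -> : \sum_(s in derangements n) specht_repr n la s = young_eigenvalue%:M.
  apply: val_submod_inj.
  transitivity
    (val_submod (1%:M : 'M_(\rank (specht_mx n la))) *m derangement_mx).
    rewrite mulmx_sumr linear_sum; apply: eq_bigr => s _.
    by rewrite -(val_submodJ (cyclic_mx_module aG _)) ?inE // mul1mx.
  rewrite -[young_eigenvalue]mulr1 -scale_scalar_mx linearZ /=.
  apply/row_matrixP=> i; rewrite row_mul [RHS]linearZ /=.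
  have /cyclic_mxP[A EA ->] :
      (row i (val_submod (1%:M : 'M_(\rank (specht_mx n la))))
         <= specht_mx n la)%MS.
    exact: submx_trans (row_sub _ _) (val_submodP _).
  by rewrite -mulmxA derangement_mxC // mulmxA young_derangement // -scalemxAl.
rewrite mxtrace_scalar -[young_eigenvalue *+ _]mulr_natl mulKf //.
rewrite pnatr_eq0 mxrank_eq0 cyclic_mx_eq0; apply/eqP=> v0.
by have /eqP := coord_young1; rewrite v0 /coord mxE eq_sym oner_eq0.
Qed.
End Coordinates.
End YoungSymmetrizer.

(** * Positivity of the sum over the row stabilizer *)

Lemma nth_le_head la r : sorted geq la -> nth 0 la r <= head 0 la.
Proof.
case: la => [|m la] /=; first by rewrite nth_nil.
move/(order_path_min (rev_trans leq_trans))/allP => le_m.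
case: r => [|r] //=; have [lt_r | ge_r] := ltnP r (size la).
  exact/le_m/mem_nth.
by rewrite nth_default.
Qed.

(** Take the cyclic shift of the first row by one cell. *)
Lemma first_row_derangement n la :
  sumn la = n -> 1 < head 0 la ->
  exists2 p, p \in row_stab n la
    & forall i : 'I_n, (p i == i) = (row_of la i != 0).
Proof.
move=> sum_la; set k := head 0 la => k_gt1.
have k_gt0 : 0 < k by apply: ltnW.
have /fin_all_exists[f fP] (i : 'I_n) : exists j : 'I_n,
    if row_of la i == 0 then row_of la j = 0 /\ col_of la j = (col_of la i).+1 %% k
    else j = i.
  case: eqP => _; last by exists i.
  have lt_k : (col_of la i).+1 %% k < nth 0 la 0 by rewrite nth0 ltn_mod.
  by have [j rj cj] := cell_exists sum_la lt_k; exists j.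
have lt_col i : row_of la i = 0 -> (i : nat) < n -> col_of la i < k.
  move=> ri lt_i; have := col_lt_row_size (Ordinal lt_i) sum_la.
  by rewrite /= ri nth0.
have row_f i : row_of la (f i) = row_of la i.
  by have := fP i; case: eqP => [-> [] | _ ->].
have f_inj : injective f.
  move=> i j fij; have rij : row_of la i = row_of la j by rewrite -row_f fij row_f.
  have := fP i; have := fP j; rewrite -rij fij; case: eqP => [ri|_ -> //].
  case=> _ -> [_ /eqP]; rewrite -[_.+1]addn1 -[in X in _ == X]addn1 eqn_modDr.
  rewrite !modn_small ?lt_col -?rij // eq_sym => /eqP cij.
  exact/val_inj/(@cell_inj la).
exists (perm f_inj) => [|i].
  by rewrite inE; apply/forallP=> i; rewrite permE row_f.
rewrite permE; have := fP i; case: eqP => [ri [_ cf] | _ ->]; last by rewrite eqxx.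
apply/eqP=> fi; move: cf (lt_col i ri (ltn_ord i)); rewrite fi.
(* A fixed cell would give col + 1 = col, or in the last column 0 = col and hence k = 1. *)
have [lt_k | gt_k | eq_k] := ltngtP (col_of la i).+1 k.
- by rewrite modn_small // => /eqP; rewrite (ltn_eqF (ltnSn _)).
- by [].
by rewrite eq_k modnn => c0; move: k_gt1; rewrite -eq_k c0.
Qed.

(* algC is only partially ordered, and Num.sg is the usual sign only on its
   real elements, hence the first conjunct. *)
Theorem theorem1p2 (n : nat) (la : seq nat)
    (n_ge2 : 2 <= n) (la_part : is_partition n la) :
  [/\ eta n la \is Num.real,
      eta n la != 0%R,
      Num.sg (eta n la) = ((-1) ^+ (n - head 0 la)%N)%R,
      ~~ odd (n - head 0 la) -> (0 < eta n la)%R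
    & odd (n - head 0 la) -> (eta n la < 0)%R].
Proof.
have /and3P[la_sorted la_pos /eqP sum_la] := la_part.
set k := head 0 la.
have k_gt0 : 0 < k.
  rewrite /k; case: (la) la_pos sum_la => [_ /= n0|m s /andP[] //].
  by rewrite -n0 in n_ge2.
have le_kn : k <= n.
  by rewrite /k -sum_la; case: (la) => //= m s; apply: leq_addr.
have lt_col (i : 'I_n) : col_of la i < k.
  exact: leq_trans (col_lt_row_size i sum_la) (nth_le_head _ la_sorted).
pose c i := Ordinal (lt_col i).
pose w (p : 'S_n) a : algC := (- fibre_weight c (fun i => (p i == i)%:R) a)%R.
have eta_w : eta n la
    = ((-1) ^+ (n - k) * \sum_(p in row_stab n la) \prod_a w p a)%R.
  rewrite eta_young_eigenvalue // mulr_sumr; apply: eq_bigr => p _.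
  (* There are [k] columns, and n - k has the parity of n + k. *)
  rewrite -signr_odd oddB // -oddD signr_odd -(fibre_alternating_sum _ c).
  by apply: eq_bigl => q; rewrite inE.
(* No column is empty; an empty fibre would have [w] equal to -1. *)
have top_cell (a : 'I_k) : exists2 i : 'I_n, row_of la i = 0 & c i = a.
  have lt_a : a < nth 0 la 0 by rewrite nth0.
  by have [i ri ci] := cell_exists sum_la lt_a; exists i => //; apply: val_inj.
have w_ge0 p a : (0 <= w p a)%R.
  have [i _ <-] := top_cell a; apply: opp_fibre_weight_ge0 => j.
  by rewrite ler0n lern1 leq_b1.
have [p0 p0R w_gt0] : exists2 p, p \in row_stab n la & forall a, (0 < w p a)%R.
  have [k_gt1 | k_le1] := ltnP 1 k.
    have [p pR pP] := first_row_derangement sum_la k_gt1.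
    exists p => // a; have [i ri <-] := top_cell a.
    apply: opp_fibre_weight_gt0; last by left; rewrite pP ri.
    move=> j cj ji; rewrite pP; apply: contraNneq ji => rj.
    apply/eqP/val_inj/(@cell_inj la); first by rewrite ri.
    exact: (congr1 val cj).
  exists 1%g => [|a]; first exact: group1.
  have [i _ <-] := top_cell a; apply: opp_fibre_weight_gt0 => [j _ _|].
    by rewrite perm1.
  right; rewrite perm1 eqxx.
  (* With a single column, [n_ge2] supplies a second cell in it. *)
  have /card_gt1P[x [y [_ _ xy]]] : 1 < #|'I_n| by rewrite card_ord.
  have c_eq j : c j = c i.
    have le0 (b : 'I_k) : b = 0 :> nat.
      by apply/eqP; rewrite -leqn0 -ltnS (leq_trans (ltn_ord b)).
    exact/val_inj/(etrans (le0 _) (esym (le0 _))).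
  have [xi | xi] := eqVneq x i; last by exists x.
  by exists y => //; rewrite -xi eq_sym.
have sum_gt0 : (0 < \sum_(p in row_stab n la) \prod_a w p a)%R.
  rewrite (bigD1 p0) //= ltr_wpDr ?prodr_gt0 // sumr_ge0 // => p _.
  exact: prodr_ge0.
rewrite eta_w -signr_odd; case: (odd _); rewrite ?expr1 ?expr0 ?mulN1r ?mul1r.
  by rewrite ltr0_sg oppr_lt0 // oppr_eq0 lt0r_neq0 // rpredN gtr0_real.
by rewrite gtr0_sg // lt0r_neq0 // gtr0_real.
Qed.
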